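(* Let $(\mathcal X,\psi)$ be a Polish metric space, $V:\mathcal X\to[0,\infty)$ continuous, $\alpha\in(0,1)$, $\gamma>0$, $A>0$, and let $s=\gamma/(1-\alpha)$. Define $$c_{\alpha,\gamma,A}(x,y):=\psi(x,y)^\alpha\{A+V(x)+V(y)\}^{\gamma},\qquad d_{\alpha,\gamma,A}(x,y):=\inf_{m\ge1}\ \inf_{x=z_0,\ldots,z_m=y}\ \sum_{i=1}^mc_{\alpha,\gamma,A}(z_{i-1},z_i),$$ where the inner infimum is over all finite sequences $z_0,\dots,z_m$ in $\mathcal X$ from $x$ to $y$. Then for every $x,y\in\mathcal X$, $$A^\gamma\psi(x,y)^\alpha\le d_{\alpha,\gamma,A}(x,y)\le c_{\alpha,\gamma,A}(x,y).$$ Consequently, $d_{\alpha,\gamma,A}$ is a Polish metric with the same topology and Borel sets as $\psi$, and $$\{g:\mathcal X\to\mathbb R:\ |g(x)-g(y)|\le c_{\alpha,\gamma,A}(x,y)\ \text{for all }x,y\in\mathcal X\}=\{g:\mathcal X\to\mathbb R:\ \operatorname{Lip}_{d_{\alpha,\gamma,A}}(g)\le1\}.$$ If $\mu,\nu$ are Borel probability measures on $\mathcal X$ with $\mu(V^s)<\infty$ and $\nu(V^s)<\infty$, then $$W_{d_{\alpha,\gamma,A}}(\mu,\nu)\le C_{\alpha,\gamma}\,W_\psi(\mu,\nu)^\alpha\{A^s+\mu(V^s)+\nu(V^s)\}^{1-\alpha},$$ where $C_{\alpha,\gamma}=c_s^{1-\alpha}$ with $c_s=1$ if $0<s\le1$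 and $c_s=3^{s-1}$ if $s>1$.
   Context: Polish metric (space): complete separable metric (space). For a metric $d$ and a real-valued function $g$, $\operatorname{Lip}_d(g)=\sup_{x\ne y}|g(x)-g(y)|/d(x,y)$, and $W_d(\mu,\nu)=\inf_\Gamma\int d(x,y)\,\Gamma(dx,dy)$ over all couplings $\Gamma$ of $\mu$ and $\nu$ (possibly $+\infty$). $\mu(V^s)=\int V^s\,d\mu$. *)

(* Defs.v *)
(* MathComp-Analysis *)
From HB Require Import structures.
From mathcomp Require Import all_boot all_order all_algebra.
From mathcomp Require Import all_classical all_reals all_analysis.

Set Implicit Arguments.
Unset Strict Implicit.
Unset Printing Implicit Defensive.

Import Order.TTheory GRing.Theory Num.Theory.
Import numFieldNormedType.Exports.

Local Open Scope classical_set_scope.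
Local Open Scope ring_scope.

(* The axiom of [completeType], without its [Pointed] parent, so that the empty
   space is not excluded. *)
Definition complete_space (T : uniformType) : Prop :=
  forall F : set_system T, ProperFilter F -> cauchy F -> exists l : T, F --> l.

Definition separable_space (T : topologicalType) : Prop :=
  exists2 D : set T, countable D & dense D.

Definition polish_metric_space (R : realType) (T : metricType R) : Prop :=
  complete_space T /\ separable_space T.

Record is_metric (R : realType) (T : Type) (d : T -> T -> R) : Prop := IsMetric {
  is_metric_xx : forall x, d x x = 0;
  is_metric_eq0 : forall x y, d x y = 0 -> x = y;
  is_metric_sym : forall x y, d x y = d y x;
  is_metric_triangle : forall y x z, d x z <= d x y + d y z
}.

(* [metric_space dP] is a copy of [T] carrying the metric [d] and the topology
   of [d], whatever metric or topology [T] itself may have. *)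
Definition metric_space (R : realType) (T : choiceType) (d : T -> T -> R)
  (dP : is_metric d) : Type := T.

Section metric_space_instance.
Context (R : realType) (T : choiceType) (d : T -> T -> R) (dP : is_metric d).

HB.instance Definition _ := Choice.on (metric_space dP).
HB.instance Definition _ := @isMetric.Build R (metric_space dP) d
  (is_metric_xx dP) (is_metric_eq0 dP) (is_metric_sym dP)
  (is_metric_triangle dP).

End metric_space_instance.

Definition borel_sets (T : topologicalType) : set (set T) := <<s @open T >>.

(* [measurableType] requires a distinguished point; [x0] plays no other role,
   and a space with a probability measure has one. *)
Definition borel_space (T : topologicalType) (x0 : T) : Type := T.

Section borel_space_instance.
Context (T : topologicalType) (x0 : T).

HB.instance Definition _ := Choice.on (borel_space x0).
HB.instance Definition _ := isPointed.Build (borel_space x0) x0.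

Let borel_setsC (A : set (borel_space x0)) :
  borel_sets (A : set T) -> borel_sets (~` A : set T).
Proof. by move=> mA; rewrite -setTD; exact: sigma_algebraCD. Qed.

HB.instance Definition _ := @isMeasurable.Build (sigma_display (@open T))
  (borel_space x0) (@borel_sets T) (@sigma_algebra0 _ setT (@open T))
  borel_setsC (@sigma_algebra_bigcup _ setT (@open T)).

End borel_space_instance.

(* The quotients are nonnegative; [0] only matters on a space with at most one
   point, where the supremum is over the empty set. *)
Definition Lip (R : realType) (T : Type) (d : T -> T -> R) (g : T -> R)
    : \bar R :=
  maxe 0%E (ereal_sup [set r : \bar R |
    exists x y : T, x <> y /\ r = (`|g x - g y| / d x y)%:E]).

(* Couplings live on the product sigma-algebra, which for a separable metric
   space is the Borel sigma-algebra of the product. *)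
Definition coupling (R : realType) (disp : measure_display)
    (T : measurableType disp) (mu nu : probability T R)
    : set (probability (T * T)%type R) :=
  [set G | forall A : set T, measurable A ->
     pushforward G fst A = mu A /\ pushforward G snd A = nu A].

Definition Wass (R : realType) (disp : measure_display)
    (T : measurableType disp) (mu nu : probability T R) (d : T -> T -> R)
    : \bar R :=
  ereal_inf [set (\int[G]_z (d z.1 z.2)%:E)%E | G in coupling mu nu].

Definition cost (R : realType) (T : metricType R) (V : T -> R)
    (alpha gamma A : R) (x y : T) : R :=
  mdist x y `^ alpha * (A + V x + V y) `^ gamma.

Definition chains (T : Type) (m : nat) (x y : T) : set (nat -> T) :=
  [set z | z 0%N = x /\ z m = y].

Definition chain_cost (R : realType) (T : metricType R) (V : T -> R)
    (alpha gamma A : R) (m : nat) (z : nat -> T) : R :=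
  \sum_(1 <= i < m.+1) cost V alpha gamma A (z i.-1) (z i).

Definition chain_dist (R : realType) (T : metricType R) (V : T -> R)
    (alpha gamma A : R) (x y : T) : R :=
  inf [set inf [set chain_cost V alpha gamma A m z | z in chains m x y]
      | m in [set m : nat | (1 <= m)%N]].

(* The constant in [(a + b + c) `^ s <= sum3_pow_const s * (a `^ s + b `^ s + c `^ s)]
   for nonnegative [a], [b], [c]. *)
Definition sum3_pow_const (R : realType) (s : R) : R :=
  if s <= 1 then 1 else 3 `^ (s - 1).

(* Main.v *)
Require Import Defs.
From HB Require Import structures.
From mathcomp Require Import all_boot all_order all_algebra.
From mathcomp Require Import all_classical all_reals all_analysis.
From mathcomp Require Import measurable_realfun.
From mathcomp Require Import ring lra.

Set Implicit Arguments.
Unset Strict Implicit.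
Unset Printing Implicit Defensive.

Import Order.TTheory GRing.Theory Num.Theory.
Import numFieldNormedType.Exports.

Local Open Scope classical_set_scope.
Local Open Scope ring_scope.

(** [A^gamma psi^alpha] satisfies the triangle inequality, because [t^alpha] is
    subadditive, and minorizes the cost, hence minorizes the cost of every
    chain; so does [|g x - g y|] when [g] satisfies the Lipschitz condition for
    the cost.  As the cost tends to [0] on the diagonal, balls of the chain
    distance and of [psi] are nested in each other, uniformly in the direction
    needed for completeness.  For a coupling [G], Hoelder's inequality with
    exponents [1 / alpha] and [1 / (1 - alpha)] bounds the integral of the cost
    by [(int psi dG)^alpha (int (A + V x + V y)^s dG)^(1 - alpha)], whose second
    factor is controlled by the marginals alone. *)

(** * Subadditivity and convexity of real powers *)

(** The fractions [a / (a + b)] and [b / (a + b)] sum to 1, and each, lying in (0, 1], is at most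
    its own power of exponent [r <= 1]. *)
Lemma powRD_subadditive (R : realType) (r a b : R) :
  0 < r -> r <= 1 -> 0 <= a -> 0 <= b -> (a + b) `^ r <= a `^ r + b `^ r.
Proof.
move=> r0 r1; rewrite le_eqVlt => /predU1P[<- _|a0].
  by rewrite add0r powR0 ?gt_eqF// add0r.
rewrite le_eqVlt => /predU1P[<-|b0].
  by rewrite addr0 powR0 ?gt_eqF// addr0.
have ab0 : 0 < a + b by rewrite addr_gt0.
have frac x y : 0 < x -> 0 < y -> (x + y) `^ r * (x / (x + y)) <= x `^ r.
  move=> x0 y0; have xy0 : 0 < x + y by rewrite addr_gt0.
  have xy1 : 0 < x / (x + y) <= 1.
    by rewrite divr_gt0//= ler_pdivrMr// mul1r lerDl ltW.
  have -> : x `^ r = (x + y) `^ r * (x / (x + y)) `^ r.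
    by rewrite -powRM ?ltW ?(andP xy1).1// mulrC divfK// gt_eqF.
  by rewrite ler_wpM2l ?powR_ge0// ger1_powR.
have -> : (a + b) `^ r =
    (a + b) `^ r * (a / (a + b)) + (b + a) `^ r * (b / (b + a)).
  by rewrite (addrC b) -mulrDr -mulrDl divff ?mulr1// gt_eqF.
by rewrite lerD// frac.
Qed.

Lemma powR_convex (R : realType) (s t a b : R) :
  1 <= s -> 0 <= t -> t <= 1 -> 0 <= a -> 0 <= b ->
  (t * a + (1 - t) * b) `^ s <= t * a `^ s + (1 - t) * b `^ s.
Proof.
move=> s1 t0 t1 a0 b0.
have := @convex_powR R s s1 (Itv01 t0 t1) a b.
by rewrite !convRE /= !inE/= !in_itv/= a0 b0; exact.
Qed.

(** Subadditivity used twice if [s <= 1]; otherwise convexity of the power at the mean of [a], [b],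
    [c]. *)
Lemma powR_sum3 (R : realType) (s a b c : R) :
  0 < s -> 0 <= a -> 0 <= b -> 0 <= c ->
  (a + b + c) `^ s <= sum3_pow_const s * (a `^ s + b `^ s + c `^ s).
Proof.
move=> s0 a0 b0 c0; rewrite /sum3_pow_const; case: ifPn => [s1|].
  rewrite mul1r (le_trans (powRD_subadditive s0 s1 (addr_ge0 a0 b0) c0))//.
  by rewrite lerD2r powRD_subadditive.
rewrite -ltNge => /ltW s1.
have step : ((a + b + c) / 3) `^ s <= (a `^ s + b `^ s + c `^ s) / 3.
  (* Convexity is available for two points, so the mean is nested: weight 1/3 on [a], then 1/2 on
     each of [b] and [c]. *)
  have -> : (a + b + c) / 3 =
      3^-1 * a + (1 - 3^-1) * (2^-1 * b + (1 - 2^-1) * c) by field.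
  apply: (le_trans (powR_convex s1 _ _ a0 _)); [lra|lra| |].
    by apply: addr_ge0; apply: mulr_ge0 => //; lra.
  have -> : (a `^ s + b `^ s + c `^ s) / 3 =
      3^-1 * a `^ s + (1 - 3^-1) * (2^-1 * b `^ s + (1 - 2^-1) * c `^ s).
    by field.
  rewrite lerD2l ler_wpM2l ?powR_convex//; lra.
have -> : (a + b + c) `^ s = 3 `^ s * ((a + b + c) / 3) `^ s.
  by rewrite -powRM ?divr_ge0 ?addr_ge0// mulrC divfK.
rewrite (le_trans (ler_wpM2l (powR_ge0 _ _) step))//.
(* One factor 3 cancels the denominator, which lowers the exponent of 3 to [s - 1]. *)
rewrite -[in leLHS](@mulr_powRB1 _ 3 s)// le_eqVlt; apply/orP; left.
by apply/eqP; field.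
Qed.

(** * The chain distance: bounds, metric axioms, Lipschitz functions *)

Section chain_distance.
Context (R : realType) (X : metricType R) (V : X -> R).
Hypothesis V_ge0 : forall x, 0 <= V x.
Variables alpha gamma A : R.
Hypotheses (alpha_gt0 : 0 < alpha) (alpha_lt1 : alpha < 1).
Hypotheses (gamma_gt0 : 0 < gamma) (A_gt0 : 0 < A).

Local Notation c := (cost V alpha gamma A).
Local Notation cc := (chain_cost V alpha gamma A).
Local Notation d := (chain_dist V alpha gamma A).

Lemma cost_ge0 x y : 0 <= c x y.
Proof. by rewrite /cost mulr_ge0// powR_ge0. Qed.

Lemma cost_sym x y : c x y = c y x.
Proof. by rewrite /cost metric_sym addrAC. Qed.

Lemma cost_xx x : c x x = 0.
Proof. by rewrite /cost mdistxx powR0 ?mul0r// gt_eqF. Qed.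

Lemma cost_ge x y : A `^ gamma * mdist x y `^ alpha <= c x y.
Proof.
rewrite /cost mulrC ler_wpM2l ?powR_ge0//.
rewrite ge0_ler_powR ?nnegrE ?addr_ge0 ?(ltW A_gt0) ?(ltW gamma_gt0)//.
by rewrite -addrA lerDl addr_ge0.
Qed.

Lemma chain_costE m z : cc m z = \sum_(i < m) c (z i) (z i.+1).
Proof. by rewrite /chain_cost big_add1/= big_mkord. Qed.

Lemma chain_cost_ge0 m z : 0 <= cc m z.
Proof. by rewrite chain_costE sumr_ge0// => i _; exact: cost_ge0. Qed.

(** Jumps to [y] at the first step and stays there; this witness keeps the inner infima from ranging
    over an empty set, where [inf] takes a default value. *)
Lemma chain_of_length_gt0 m (x y : X) :
  (1 <= m)%N -> chains m x y (fun i => if i is 0 then x else y).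
Proof. by case: m. Qed.

(** Together with [chain_dist_le], the only access to the nested infima. *)
Lemma chain_dist_ge x y l :
  (forall m z, (1 <= m)%N -> chains m x y z -> l <= cc m z) -> l <= d x y.
Proof.
move=> h; apply: lb_le_inf; first by eexists; exists 1%N.
move=> _ [m m1 <-]; apply: lb_le_inf.
  by eexists; eexists; [exact: chain_of_length_gt0 m1|].
by move=> _ [z xyz <-]; exact: h.
Qed.

Lemma chain_dist_le m z x y :
  (1 <= m)%N -> chains m x y z -> d x y <= cc m z.
Proof.
move=> m1 xyz.
apply: (@le_trans _ _ (inf [set cc m z | z in chains m x y])).
  apply: ge_inf; last by exists m.
  exists 0 => _ [k k1 <-]; apply: lb_le_inf.
    by eexists; eexists; [exact: chain_of_length_gt0 k1|].
  by move=> _ [w _ <-]; exact: chain_cost_ge0.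
apply: ge_inf; last by exists z.
by exists 0 => _ [w _ <-]; exact: chain_cost_ge0.
Qed.

Lemma chain_dist_le_cost x y : d x y <= c x y.
Proof.
have := chain_dist_le (leqnn 1) (chain_of_length_gt0 x y (leqnn 1)).
by rewrite chain_costE big_ord1.
Qed.

(** Telescoping along the chain by the triangle inequality for [l]; the bound on the diagonal serves
    the chain of no steps. *)
Lemma le_chain_cost (l : X -> X -> R) :
  (forall x, l x x <= 0) -> (forall y x z, l x z <= l x y + l y z) ->
  (forall x y, l x y <= c x y) ->
  forall m z, l (z 0%N) (z m) <= cc m z.
Proof.
move=> l0 ltri lc m z; rewrite chain_costE; elim: m => [|m ih].
  by rewrite big_ord0.
by rewrite big_ord_recr/= (le_trans (ltri (z m) _ _))// lerD.
Qed.

(** Maximality of the chain distance among the functions with these three properties. It yields both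
    the lower bound by [mdist] and the Lipschitz characterization. *)
Lemma le_chain_dist (l : X -> X -> R) :
  (forall x, l x x <= 0) -> (forall y x z, l x z <= l x y + l y z) ->
  (forall x y, l x y <= c x y) ->
  forall x y, l x y <= d x y.
Proof.
move=> l0 ltri lc x y; apply: chain_dist_ge => m z _ [<- <-].
exact: le_chain_cost.
Qed.

Lemma chain_dist_ge_mdist x y : A `^ gamma * mdist x y `^ alpha <= d x y.
Proof.
apply: (@le_chain_dist (fun x y => A `^ gamma * mdist x y `^ alpha)).
- by move=> z; rewrite mdistxx powR0 ?gt_eqF// mulr0.
- move=> v u w; rewrite -mulrDr ler_wpM2l ?powR_ge0//.
  have dge0 p q : 0 <= @mdist R X p q by exact: mdist_ge0.
  rewrite (le_trans _ (powRD_subadditive _ (ltW alpha_lt1) _ _))//.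
  by rewrite ge0_ler_powR ?nnegrE ?addr_ge0 ?(ltW alpha_gt0)// metric_triangle.
- exact: cost_ge.
Qed.

(** Reversing a chain preserves its cost, since [c] is symmetric. *)
Lemma chain_dist_sym_le x y : d x y <= d y x.
Proof.
apply: chain_dist_ge => m z m1 [z0 zm].
have -> : cc m z = cc m (fun i => z (m - i)%N).
  rewrite !chain_costE (reindex_inj rev_ord_inj)/=.
  apply: eq_bigr => -[i im] _ /=.
  by rewrite cost_sym subnSK.
apply: chain_dist_le => //; split; first by rewrite subn0.
by rewrite subnn.
Qed.

(** The two infima on the right are handled one after the other; it then remains to concatenate a
    chain [u] from [x] to [y] with a chain [v] from [y] to [z]. *)
Lemma chain_dist_triangle y x z : d x z <= d x y + d y z.
Proof.
rewrite -lerBlDr; apply: chain_dist_ge => m u m1 [u0 um].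
rewrite lerBlDr -lerBlDl; apply: chain_dist_ge => n v n1 [v0 vn].
rewrite lerBlDl.
pose w i := if (i <= m)%N then u i else v (i - m)%N.
have -> : cc m u + cc n v = cc (m + n) w.
  rewrite !chain_costE big_split_ord/=; congr (_ + _); apply: eq_bigr.
    by move=> i _; rewrite /w ltn_ord ltnW.
  move=> i _; rewrite /w -addnS !addKn.
  have -> : (m + i.+1 <= m)%N = false by rewrite -{2}(addn0 m) leq_add2l.
  (* Only [i = 0] falls in the first branch of [w]: at the junction [w m] is [u m], which is [y],
     hence [v 0]. *)
  case: leqP => [|//].
  rewrite -{2}(addn0 m) leq_add2l leqn0 => /eqP ->.
  by rewrite addn0 um v0.
apply: chain_dist_le; first by rewrite addn_gt0 m1.
split; first by rewrite /w.
(* As [n] is positive, the endpoint lies in the second branch. *)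
rewrite /w addKn -{2}(addn0 m) leq_add2l leqn0.
by case: eqP n1 => // ->.
Qed.

Lemma chain_dist_is_metric : is_metric d.
Proof.
split.
- move=> x; apply/eqP; rewrite eq_le -{1}(cost_xx x) chain_dist_le_cost/=.
  by apply: chain_dist_ge => *; exact: chain_cost_ge0.
- move=> x y dxy; apply: mdist_positivity.
  have := chain_dist_ge_mdist x y; rewrite dxy pmulr_rle0 ?powR_gt0// => h.
  apply: (@powR_eq0_eq0 _ _ alpha); apply/eqP.
  by rewrite eq_le h powR_ge0.
- by move=> x y; apply/eqP; rewrite eq_le !chain_dist_sym_le.
- exact: chain_dist_triangle.
Qed.

(** From [c] to [d] by maximality of the chain distance, back by [d <= c]; the lower bound on [d]
    makes the denominators positive off the diagonal. *)
Lemma le_cost_Lip :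
  [set g : X -> R | forall x y, `|g x - g y| <= c x y] =
  [set g : X -> R | (Lip d g <= 1)%E].
Proof.
apply/seteqP; split => g /=.
- move=> gc; rewrite /Lip ge_max lee01/=.
  apply: ge_ereal_sup => _ [x [y [xy ->]]]; rewrite lee_fin.
  have d0 : 0 < d x y.
    rewrite (lt_le_trans _ (chain_dist_ge_mdist x y))// mulr_gt0 ?powR_gt0//.
    by rewrite mdist_gt0; exact/eqP.
  rewrite ler_pdivrMr// mul1r.
  apply: (@le_chain_dist (fun x y => `|g x - g y|)) => //.
    by move=> z; rewrite subrr normr0.
  by move=> v u w; exact: ler_distD.
- rewrite /Lip ge_max => /andP[_ Lg] x y.
  have [->|xy] := eqVneq x y; first by rewrite subrr normr0 cost_ge0.
  have d0 : 0 < d x y.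
    rewrite (lt_le_trans _ (chain_dist_ge_mdist x y))// mulr_gt0 ?powR_gt0//.
    by rewrite mdist_gt0.
  apply: le_trans (chain_dist_le_cost x y).
  rewrite -[leRHS]mul1r -ler_pdivrMr// -lee_fin.
  apply: le_trans Lg; apply: ereal_sup_ubound; exists x, y; split => //.
  exact/eqP.
Qed.

End chain_distance.

(** * Transfer of topology and Polishness between two metrics *)

Section remetrization.
Context (R : realType) (X : metricType R) (d : X -> X -> R).
Hypothesis dP : is_metric d.
Hypothesis d_mdist : forall e, 0 < e ->
  exists2 r, 0 < r & forall x y, d x y < r -> mdist x y < e.
Hypothesis mdist_d : forall x e, 0 < e ->
  exists2 r, 0 < r & forall y, mdist x y < r -> d x y < e.

Local Notation M := (metric_space dP).

Lemma metric_space_nbhsE (x : X) : @nbhs M M x = @nbhs X X x.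
Proof.
rewrite predeqE => B; split=> /nbhs_ballP[e /= e0 eB]; apply/nbhs_ballP.
  have [r r0 rP] := mdist_d x e0; exists r => // y.
  by rewrite ballEmdist => /rP dxy; apply: eB; rewrite ballEmdist.
have [r r0 rP] := d_mdist e0; exists r => // y.
by rewrite ballEmdist => /rP dxy; apply: eB; rewrite ballEmdist.
Qed.

Lemma metric_space_openE : @open M = @open X.
Proof.
apply/seteqP; split => U; rewrite !openE => + x => /(_ x) /[apply];
  by rewrite /interior metric_space_nbhsE.
Qed.

(** A Cauchy filter for [d] is Cauchy for [mdist] because the radius in [d_mdist] is independent of
    the centre; limits and dense sets carry over since the topologies agree. *)
Lemma metric_space_polish : polish_metric_space X -> polish_metric_space M.
Proof.
move=> [Xc [D cD dD]]; split.
  move=> F PF /cauchyP cF.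
  have [|l Fl] := Xc F PF.
    apply/cauchyP => e e0; have [r r0 rP] := d_mdist e0.
    have [x xr] := cF r r0; exists x; apply: filterS xr => y.
    by rewrite !ballEmdist => /rP.
  by exists l; rewrite /cvg_to/= => B; rewrite metric_space_nbhsE; exact: Fl.
exists D => // U U0 oU; apply: dD U0 _.
by rewrite -metric_space_openE.
Qed.

End remetrization.

(** * Comparison of small balls of [psi] and of the chain distance *)

Section chain_topology.
Context (R : realType) (X : metricType R) (V : X -> R).
Hypotheses (V_ge0 : forall x, 0 <= V x) (V_cont : continuous V).
Variables alpha gamma A : R.
Hypotheses (alpha_gt0 : 0 < alpha) (alpha_lt1 : alpha < 1).
Hypotheses (gamma_gt0 : 0 < gamma) (A_gt0 : 0 < A).

Local Notation d := (chain_dist V alpha gamma A).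

Lemma chain_dist_lt_mdist e : 0 < e ->
  exists2 r, 0 < r & forall x y, d x y < r -> mdist x y < e.
Proof.
move=> e0; exists (A `^ gamma * e `^ alpha).
  by rewrite mulr_gt0 ?powR_gt0.
move=> x y dxy.
have := le_lt_trans (chain_dist_ge_mdist V_ge0 alpha_gt0 alpha_lt1 gamma_gt0
  A_gt0 x y) dxy.
rewrite ltr_pM2l ?powR_gt0// !ltNge; apply: contra => exy.
by rewrite ge0_ler_powR ?nnegrE ?mdist_ge0 ?(ltW alpha_gt0) ?(ltW e0).
Qed.

Lemma mdist_lt_chain_dist x e : 0 < e ->
  exists2 r, 0 < r & forall y, mdist x y < r -> d x y < e.
Proof.
move=> e0.
have /nbhs_ballP[r1 /= r10 Vr1] : \forall y \near x, V y < V x + 1.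
  have h : nbhs (V x) [set v | v < V x + 1] by apply: lt_nbhsl; rewrite ltrDl.
  exact: V_cont h.
(* [M] bounds the second factor of the cost where [V y < V x + 1]; the radius below makes the first
   factor less than [e / M]. *)
pose M := (A + V x + (V x + 1)) `^ gamma.
have M0 : 0 < M by have Vx := V_ge0 x; apply: powR_gt0; have := A_gt0; lra.
exists (Num.min r1 ((e / M) `^ alpha^-1)).
  by rewrite lt_min r10 powR_gt0// divr_gt0.
move=> y; rewrite lt_min => /andP[xyr1 xyr2].
apply: (le_lt_trans (chain_dist_le_cost _ _ _ _ _ _)).
rewrite /cost -(divfK (lt0r_neq0 M0) e).
apply: (@le_lt_trans _ _ (mdist x y `^ alpha * M)).
  rewrite ler_wpM2l ?powR_ge0//.
  rewrite ge0_ler_powR ?nnegrE ?addr_ge0 ?(ltW gamma_gt0) ?(ltW A_gt0)//.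
  by rewrite lerD2l ltW// Vr1//= ballEmdist.
rewrite ltr_pM2r//.
have := gt0_ltr_powR alpha_gt0 _ _ xyr2.
rewrite -powRrM mulVf ?gt_eqF// powRr1 ?divr_ge0 ?(ltW e0) ?(ltW M0)//.
by apply; rewrite nnegrE ?powR_ge0// mdist_ge0.
Qed.

End chain_topology.

(** * Integral inequalities and infima of powers *)

(* Measurability is not needed because the integral of a nonnegative function is
   a supremum over the simple functions below it. *)
Lemma ge0_le_integral_nonmeas (disp : measure_display) (T : measurableType disp)
    (R : realType) (mu : {measure set T -> \bar R}) (f g : T -> \bar R) :
  (forall x, 0 <= f x)%E -> (forall x, f x <= g x)%E ->
  (\int[mu]_x f x <= \int[mu]_x g x)%E.
Proof.
move=> f0 fg; have g0 x : (0 <= g x)%E by exact: le_trans (f0 x) (fg x).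
rewrite !ge0_integralTE//; apply: ereal_sup_le => _ [h /= hf <-].
by exists h => //= x; exact: le_trans (hf x) (fg x).
Qed.

Lemma measurable_fun_powR (disp : measure_display) (T : measurableType disp)
    (R : realType) (f : T -> R) r :
  measurable_fun setT f -> measurable_fun setT (fun x => f x `^ r).
Proof. by move=> mf; exact: (measurableT_comp (measurable_powR r) mf). Qed.

(** Hoelder's inequality for the powers of [f] and [g] with exponents [a^-1] and [(1 - a)^-1], whose
    norms are then powers of the plain integrals. *)
Lemma hoelder_integral_powR (disp : measure_display)
    (T : measurableType disp) (R : realType) (mu : {measure set T -> \bar R})
    (f g : T -> R) (a : R) :
  0 < a -> a < 1 ->
  measurable_fun setT f -> measurable_fun setT g ->
  (forall x, 0 <= f x) -> (forall x, 0 <= g x) ->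
  (\int[mu]_x (f x `^ a * g x `^ (1 - a))%:E <=
   (\int[mu]_x (f x)%:E) `^ a * (\int[mu]_x (g x)%:E) `^ (1 - a))%E.
Proof.
move=> a0 a1 mf mg f0 g0.
have b0 : 0 < 1 - a by rewrite subr_gt0.
have := @hoelder _ T R mu (fun x => f x `^ a) (fun x => g x `^ (1 - a))
  a^-1 (1 - a)^-1 (measurable_fun_powR _ mf)
  (measurable_fun_powR _ mg).
rewrite !invr_gt0 !invrK subrKC => /(_ a0 b0 erefl).
have normE (h : T -> R) r : 0 < r -> (forall x, 0 <= h x) ->
    (Lnorm mu (r^-1)%:E (EFin \o (fun x => h x `^ r)%R) =
     (\int[mu]_x (h x)%:E) `^ r)%E.
  move=> r0 h0; rewrite unlock invrK; congr (_ `^ _)%E.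
  apply: eq_integral => x _ /=.
  by rewrite ger0_norm ?powR_ge0// -powRrM divff ?gt_eqF// powRr1.
rewrite !normE// Lnorm1; apply: le_trans.
rewrite le_eqVlt; apply/orP; left; apply/eqP; apply: eq_integral => x _ /=.
by rewrite ger0_norm// mulr_ge0// powR_ge0.
Qed.

(* Raising to the power [a^-1] turns the hypothesis into a lower bound of [S],
   so no continuity of the power function is involved. *)
Lemma ereal_inf_poweR_ge (R : realType) (S : set (\bar R)) (a k : R)
    (w : \bar R) :
  0 < a -> 0 < k -> (forall x, S x -> 0 <= x)%E -> (0 <= w)%E ->
  (forall x, S x -> w <= k%:E * x `^ a)%E ->
  (w <= k%:E * (ereal_inf S) `^ a)%E.
Proof.
move=> a0 k0 S0 w0 wS.
have pos (x : \bar R) : (0 <= x)%E -> x \in `[0%E, +oo%E].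
  by rewrite in_itv/= leey andbT.
have kw0 : (0 <= k^-1%:E * w)%E by rewrite mule_ge0// lee_fin invr_ge0 ltW.
rewrite -lee_pdivrMl//.
have -> : (k^-1%:E * w = ((k^-1%:E * w) `^ a^-1) `^ a)%E.
  by rewrite -poweRrM mulVf ?gt_eqF// poweRe1.
apply: gt0_ler_poweR; rewrite ?pos ?poweR_ge0 ?(ltW a0)//.
  exact: le_ereal_inf_tmp.
apply: le_ereal_inf_tmp => x Sx.
have -> : x = ((x `^ a) `^ a^-1)%E.
  by rewrite -poweRrM divff ?gt_eqF// poweRe1// S0.
apply: gt0_ler_poweR; rewrite ?pos ?poweR_ge0 ?invr_ge0 ?(ltW a0)//.
by rewrite lee_pdivrMl// wS.
Qed.

(** * Borel measurability of continuous functions and of the metric *)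

Lemma countable_bigcup_measurable (disp : measure_display)
    (T : measurableType disp) (U : choiceType) (D : set U) (F : U -> set T) :
  countable D -> (forall q, D q -> measurable (F q)) ->
  measurable (\bigcup_(q in D) F q).
Proof.
move=> cD mF; have [->|/set0P[r Dr]] := eqVneq D set0.
  by rewrite bigcup_set0.
have /countable_injP[f injf] := cD.
(* The partial inverse of the injection [f] into the naturals, with default value [r], reindexes the
   union by natural numbers. *)
rewrite -(injpinv_image (cst r) injf) bigcup_image.
apply: bigcup_measurable => _ [q Dq <-].
by rewrite pinvKV ?inE//; exact: mF.
Qed.

Section borel.
Context (R : realType) (X : metricType R) (x0 : X).
Local Notation B := (borel_space x0).

Lemma continuous_measurable_borel (f : X -> R) :
  continuous f -> measurable_fun (setT : set B) (f : B -> R).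
Proof.
move=> fc; apply: (measurability _ (RGenOInfty.measurableE R)).
move=> _ [_ [r ->] <-]; rewrite setTI.
apply: sub_sigma_algebra; apply: open_comp.
  by move=> x _; exact: fc.
by rewrite set_itvoy; exact: open_gt.
Qed.

Lemma mdist_continuous (q : X) : continuous (fun x : X => mdist x q).
Proof.
move=> x; apply/cvgrPdist_lt => e e0; near=> y.
have xy : mdist x y < e by near: y; apply/nbhs_ballP; exists e => //= y;
  rewrite ballEmdist.
rewrite ltr_norml ltrBlDr ltrBrDr.
have h1 := metric_triangle y x q; have h2 := metric_triangle x y q.
rewrite (metric_sym y x) in h1.
by apply/andP; split; lra.
Unshelve. all: by end_near. Qed.

(* [mdist x y < r] holds iff [mdist x q + mdist y q < r] for some [q] in a
   countable dense set. *)
Lemma measurable_mdist : separable_space X ->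
  measurable_fun (setT : set (B * B)) (fun z => @mdist R X z.1 z.2).
Proof.
move=> [D cD dD].
apply: (measurability _ (RGenInftyO.measurableE R)).
move=> _ [_ [r ->] <-]; rewrite setTI.
pose near_q (q : X) : set (B * B) :=
  (fun z => @mdist R X z.1 q + @mdist R X z.2 q) @^-1` `]-oo, r[.
have -> : (fun z : B * B => @mdist R X z.1 z.2) @^-1` `]-oo, r[ =
    \bigcup_(q in D) near_q q.
  apply/seteqP; split => -[x y]; rewrite /near_q/= ?in_itv/=.
    (* Half the gap: passing through [q] costs at most [mdist x y] plus twice [mdist x q]. *)
    move=> xyr; set e := (r - mdist (x : X) y) / 2.
    have e0 : 0 < e by rewrite divr_gt0// subr_gt0.
    have [q [xq Dq]] : (@ball R X x e)^° `&` D !=set0.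
      apply: dD; last exact: open_interior.
      by exists x; exact: nbhsx_ballx.
    move/interior_subset in xq.
    exists q => //=; rewrite in_itv/=; rewrite ballEmdist/= in xq.
    have := metric_triangle (y : X) x q; rewrite (metric_sym (y : X) x).
    by rewrite /e in xq; lra.
  move=> [q Dq]; rewrite /= !in_itv/=; apply: le_lt_trans.
  by rewrite (metric_sym (y : X) q) metric_triangle.
apply: countable_bigcup_measurable => // q Dq.
have mq : measurable_fun (setT : set B) (fun x : B => @mdist R X x q).
  by apply: continuous_measurable_borel; exact: mdist_continuous.
rewrite -[near_q q]setTI; apply: measurable_funD => //.
- exact: (measurableT_comp mq measurable_fst).
- exact: (measurableT_comp mq measurable_snd).
Qed.

End borel.

(** * Moments under a coupling *)

(** Change of variables along the projections, whose image measures are the marginals. *)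
Lemma coupling_integral (disp : measure_display) (T : measurableType disp)
    (R : realType) (mu nu : probability T R)
    (G : probability (T * T)%type R) (h : T -> \bar R) :
  coupling mu nu G -> measurable_fun setT h -> (forall x, 0 <= h x)%E ->
  (\int[G]_z h z.1 = \int[mu]_x h x)%E /\
  (\int[G]_z h z.2 = \int[nu]_x h x)%E.
Proof.
move=> Gmn mh h0; split.
- transitivity (\int[pushforward G fst]_x h x)%E.
    by rewrite ge0_integral_pushforward.
  by apply: eq_measure_integral => A mA _; case: (Gmn A mA).
- transitivity (\int[pushforward G snd]_x h x)%E.
    by rewrite ge0_integral_pushforward.
  by apply: eq_measure_integral => A mA _; case: (Gmn A mA).
Qed.

Lemma sum3_pow_const_gt0 (R : realType) (s : R) : 0 < sum3_pow_const s.
Proof. by rewrite /sum3_pow_const; case: ifP => // _; rewrite powR_gt0. Qed.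

Lemma coupling_moment_le (disp : measure_display) (T : measurableType disp)
    (R : realType) (mu nu : probability T R) (G : probability (T * T)%type R)
    (V : T -> R) (A s : R) :
  0 <= A -> 0 < s -> measurable_fun setT V -> (forall x, 0 <= V x) ->
  coupling mu nu G ->
  (\int[G]_z ((A + V z.1 + V z.2) `^ s)%:E <=
   (sum3_pow_const s)%:E * ((A `^ s)%:E + \int[mu]_x (V x `^ s)%:E
                                        + \int[nu]_x (V x `^ s)%:E))%E.
Proof.
move=> A0 s0 mV V0 Gmn.
have mVs : measurable_fun (setT : set T) (fun x => (V x `^ s)%:E).
  by apply/measurable_EFinP; exact: measurable_fun_powR.
have Vs0 x : (0 <= (V x `^ s)%:E)%E by rewrite lee_fin powR_ge0.
have [<- <-] := coupling_integral Gmn mVs Vs0.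
have mVs1 := measurableT_comp mVs (@measurable_fst _ _ T T).
have mVs2 := measurableT_comp mVs (@measurable_snd _ _ T T).
(* As [G] has mass 1, the constant is an integral too, and the claim reduces to the pointwise bound
   [powR_sum3]. *)
have -> : ((A `^ s)%:E = \int[G]_z (A `^ s)%:E)%E.
  by rewrite integral_cst// [X in (_ * X)%E](probability_setT G) mule1.
have c0 := ltW (sum3_pow_const_gt0 s).
have As0 : (0 <= (A `^ s)%:E)%E by rewrite lee_fin powR_ge0.
rewrite -ge0_integralD//.
rewrite -ge0_integralD//; last 2 first.
  by move=> z _; rewrite adde_ge0.
  by apply: emeasurable_funD.
rewrite -ge0_integralZl_EFin//; last 2 first.
  by move=> z _; rewrite !adde_ge0.
  by do 2 apply: emeasurable_funD => //.
apply: ge0_le_integral_nonmeas => z; first by rewrite lee_fin powR_ge0.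
by rewrite -!EFinD -EFinM lee_fin powR_sum3.
Qed.

(** * The Wasserstein estimate *)

Section wasserstein_bound.
Context (R : realType) (X : metricType R) (V : X -> R).
Hypotheses (X_separable : separable_space X).
Hypotheses (V_ge0 : forall x, 0 <= V x) (V_cont : continuous V).
Variables alpha gamma A : R.
Hypotheses (alpha_gt0 : 0 < alpha) (alpha_lt1 : alpha < 1).
Hypotheses (gamma_gt0 : 0 < gamma) (A_gt0 : 0 < A).
Variables (x0 : X) (mu nu : probability (borel_space x0) R).

Local Notation B := (borel_space x0).
Local Notation d := (chain_dist V alpha gamma A).
Local Notation s := (gamma / (1 - alpha)).

Let s_gt0 : 0 < s. Proof. by rewrite divr_gt0// subr_gt0. Qed.

Let mV : measurable_fun (setT : set B) (V : B -> R).
Proof. exact: continuous_measurable_borel. Qed.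

Let mV1 : measurable_fun (setT : set (B * B)) (fun z => V z.1).
Proof. exact: (measurableT_comp mV measurable_fst). Qed.

Let mV2 : measurable_fun (setT : set (B * B)) (fun z => V z.2).
Proof. exact: (measurableT_comp mV measurable_snd). Qed.

Lemma Wass_chain_dist_le :
  (\int[mu]_x (V x `^ s)%:E < +oo)%E ->
  (\int[nu]_x (V x `^ s)%:E < +oo)%E ->
  (Wass mu nu d <=
     (sum3_pow_const s `^ (1 - alpha))%:E * (Wass mu nu (@mdist R X)) `^ alpha
     * ((A `^ s)%:E + \int[mu]_x (V x `^ s)%:E
                    + \int[nu]_x (V x `^ s)%:E) `^ (1 - alpha))%E.
Proof.
set Imu := (\int[mu]_x _)%E; set Inu := (\int[nu]_x _)%E => muoo nuoo.
have Imu0 : (0 <= Imu)%E.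
  by apply: integral_ge0 => x _; rewrite lee_fin powR_ge0.
have Inu0 : (0 <= Inu)%E.
  by apply: integral_ge0 => x _; rewrite lee_fin powR_ge0.
have b0 : 0 < 1 - alpha by rewrite subr_gt0.
(* Finite moments make the last factor a positive real, so it joins the constant in front of the
   power of the infimum. *)
pose S := A `^ s + fine Imu + fine Inu.
have S0 : 0 < S by rewrite /S -addrA ltr_wpDr ?powR_gt0// addr_ge0// fine_ge0.
have SE : ((A `^ s)%:E + Imu + Inu = S%:E)%E.
  by rewrite /S !EFinD !fineK// ge0_fin_numE.
have c0 := sum3_pow_const_gt0 s.
rewrite SE poweR_EFin muleAC -EFinM.
have mpsi := @measurable_mdist R X x0 X_separable.
have d_ge0 x y : 0 <= d x y.
  apply: le_trans (chain_dist_ge_mdist _ _ _ _ _ x y) => //.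
  by rewrite mulr_ge0// powR_ge0.
apply: ereal_inf_poweR_ge => //.
- by rewrite mulr_gt0 ?powR_gt0.
- by move=> _ [G _ <-]; apply: integral_ge0 => z _; rewrite lee_fin mdist_ge0.
- apply: le_ereal_inf_tmp => _ [G _ <-].
  by apply: integral_ge0 => z _; rewrite lee_fin.
(* The same coupling [G] competes in both infima. *)
move=> _ [G Gmn <-].
apply: (@le_trans _ _ (\int[G]_z (d z.1 z.2)%:E)%E).
  by apply: ereal_inf_lbound; exists G.
(* By the choice of [s], [gamma] is [s * (1 - alpha)], which gives the cost the form required by
   Hoelder's inequality. *)
apply: (@le_trans _ _ (\int[G]_z (mdist (z.1 : X) z.2 `^ alpha *
    ((A + V z.1 + V z.2) `^ s) `^ (1 - alpha))%:E)%E).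
  apply: ge0_le_integral_nonmeas => z; rewrite lee_fin//.
  rewrite -powRrM divfK ?gt_eqF//; exact: chain_dist_le_cost.
apply: le_trans.
  apply: (hoelder_integral_powR _ alpha_gt0 alpha_lt1) => //.
  - apply: measurable_fun_powR; apply: measurable_funD => //.
    by apply: measurable_funD.
  - by move=> z; exact: mdist_ge0.
  - by move=> z; exact: powR_ge0.
(* With the common distance factor removed, what remains is the moment bound raised to the power
   [1 - alpha]. *)
rewrite muleC lee_wpmul2r ?poweR_ge0// -powRM ?(ltW c0) ?(ltW S0)//.
have pos (x : \bar R) : (0 <= x)%E -> x \in `[0%E, +oo%E].
  by rewrite in_itv/= leey andbT.
rewrite -poweR_EFin; apply: gt0_ler_poweR; rewrite ?pos ?(ltW b0)//.
- by apply: integral_ge0 => z _; rewrite lee_fin powR_ge0.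
- by rewrite lee_fin mulr_ge0 ?(ltW c0) ?(ltW S0).
by rewrite EFinM -SE; apply: coupling_moment_le => //; exact: ltW.
Qed.

End wasserstein_bound.

Theorem theorem5 (R : realType) (X : metricType R)
  (X_polish : polish_metric_space X)
  (V : X -> R) (V_ge0 : forall x : X, 0 <= V x) (V_cont : continuous V)
  (alpha gamma A : R) (alpha_gt0 : 0 < alpha) (alpha_lt1 : alpha < 1)
  (gamma_gt0 : 0 < gamma) (A_gt0 : 0 < A) :
  let s : R := gamma / (1 - alpha) in
  let c : X -> X -> R := cost V alpha gamma A in
  let d : X -> X -> R := chain_dist V alpha gamma A in
  [/\ (forall x y : X,
         A `^ gamma * mdist x y `^ alpha <= d x y /\ d x y <= c x y),
      (exists dP : is_metric d,
         [/\ polish_metric_space (metric_space dP),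
             (forall U : set X,
                @open (metric_space dP) U <-> @open X U) &
             (forall B : set X,
                @borel_sets (metric_space dP) B <-> @borel_sets X B)]),
      [set g : X -> R | forall x y : X, `|g x - g y| <= c x y] =
        [set g : X -> R | (Lip d g <= 1)%E] &
      (forall (x0 : X) (mu nu : probability (borel_space x0) R),
         (\int[mu]_x (V x `^ s)%:E < +oo)%E ->
         (\int[nu]_x (V x `^ s)%:E < +oo)%E ->
         (Wass mu nu d <=
            (sum3_pow_const s `^ (1 - alpha))%:E
            * (Wass mu nu (@mdist R X)) `^ alpha
            * ((A `^ s)%:E + \int[mu]_x (V x `^ s)%:E
                           + \int[nu]_x (V x `^ s)%:E) `^ (1 - alpha))%E)].
Proof.
move=> s c d; split.
- move=> x y; split; first exact: chain_dist_ge_mdist.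
  exact: chain_dist_le_cost.
- have dP := chain_dist_is_metric V_ge0 alpha_gt0 alpha_lt1 gamma_gt0 A_gt0.
  have dm := chain_dist_lt_mdist V_ge0 alpha_gt0 alpha_lt1 gamma_gt0 A_gt0.
  have md := mdist_lt_chain_dist V_ge0 V_cont alpha_gt0 gamma_gt0 A_gt0.
  have oE := metric_space_openE dP dm md.
  exists dP; split; first exact: metric_space_polish.
    by move=> U; rewrite oE.
  by move=> U; rewrite /borel_sets oE.
- exact: le_cost_Lip.
- by move=> x0 mu nu muV nuV; apply: Wass_chain_dist_le => //; case: X_polish.
Qed.
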